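(* Let $K$ be a finite abstract simplicial complex with $n$ simplices built on a finite point set $X$ in Euclidean space, assumed to be in general position, let $\mathbf{h}=(h_1,h_2):K\to\mathbb{R}^2$ be a bi-filtering function, and let $\mathcal{R}_1=\{a_s\}_{s=0}^{m_1}$, $\mathcal{R}_2=\{b_t\}_{t=0}^{m_2}$ be sorted sets of monotonically increasing real values. Then the procedure $P$ described in the context is correct. At the end of its main loop each entry $S_{\mathbf{h}}[s][t]$ equals $\chi(K_{s,t})-\chi(K_{s-1,t})$ (with $K_{-1,t}=\emptyset$). After the cumulative sum on columns $P$ returns the Euler characteristic surface induced by $\mathbf{h}$ on $\mathcal{R}_1,\mathcal{R}_2$. The worst-case running time of $P$ is $O\big(n(\log_2(m_1)+\log_2(m_2)+m_2)+m_1m_2\big)$.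
   Context: A filtering function on $K$ is a function $h:K\to\mathbb{R}$ on the simplices of $K$ with $h(\tau)\le h(\sigma)$ whenever $\tau$ is a face of $\sigma$, so that its sublevel sets are subcomplexes. A bi-filtering function is $\mathbf{h}=(h_1,h_2):K\to\mathbb{R}^2$ with $h_1,h_2$ filtering functions. Set $K_{s,t}=\mathbf{h}^{-1}((-\infty,a_s]\times(-\infty,b_t])$. The Euler characteristic of a finite complex $Y$ is $\chi(Y)=\sum_i(-1)^i n_i$, with $n_i$ the number of $i$-dimensional simplices. The Euler characteristic surface induced by $\mathbf{h}$ on $\mathcal{R}_1,\mathcal{R}_2$ is the $(m_1+1)\times(m_2+1)$ integer matrix with entries $\chi(K_{s,t})$, $0\le s\le m_1$, $0\le t\le m_2$. Procedure $P$, with input $K$, $\mathbf{h}$ and the sorted values in $\mathcal{R}_1$ and $\mathcal{R}_2$. (1) Set $S_{\mathbf{h}}$ to the $(m_1+1)\times(m_2+1)$ zero matrix. (2) Main loop: for each simplex $\sigma$ in $K$, do the following. (a) Let $v_1=h_1(\sigma)$ and $v_2=h_2(\sigma)$. (b) By binary search, find the minimum value $a_s$ in $\mathcal{R}_1$ that is greater than or equal to $v_1$ and the minimum value $b_t$ in $\mathcal{R}_2$ that is greater than or equal to $v_2$, with their indices $s$ and $t$. (c) For $\hat t=t,\dots,m_2$, increase $S_{\mathbf{h}}[s][\hat t]$ by $(-1)^{\dim(\sigma)}$. (3) Replace $S_{\mathbf{h}}$ by its cumulative sum on columns, i.e. $S_{\mathbf{h}}[s][t]$ becomes $\sum_{s'\le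 s}S_{\mathbf{h}}[s'][t]$. (4) Return $S_{\mathbf{h}}$. Running time is the number of elementary operations. *)

(* Defs.v *)
From HB Require Import structures.
From mathcomp Require Import all_boot all_order all_algebra finmap.
From mathcomp Require Import reals exp.

Set Implicit Arguments.
Unset Strict Implicit.
Unset Printing Implicit Defensive.

Import Order.TTheory GRing.Theory Num.Theory.

Local Open Scope fset_scope.
Local Open Scope ring_scope.

Section Complexes.
Variable V : choiceType.
Implicit Types (X s : {fset V}) (K Y : {fset {fset V}}).

(* Simplices are nonempty; the vertices of K need not exhaust X. *)
Definition simplicial_complex_on X K : Prop :=
  forall s, s \in K ->
    [/\ s != fset0, s `<=` X &
        forall t : {fset V}, t != fset0 -> t `<=` s -> t \in K].

Definition dim s : nat := (#|` s|).-1.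

(* The sum ranges over every dimension i that occurs in Y. *)
Definition euler_char Y : int :=
  \sum_(i < (\max_(s <- Y) dim s).+1)
     (-1) ^+ i * (#|` [fset s in Y | dim s == i]|)%:Z.

Variable R : realDomainType.
Implicit Types (h : {fset V} -> R).

(* Only the values of h on K matter. *)
Definition filtering_function K h : Prop :=
  forall t s, t \in K -> s \in K -> t `<=` s -> h t <= h s.

Section Surface.
Variables (K : {fset {fset V}}) (h1 h2 : {fset V} -> R) (m1 m2 : nat).
Variables (a : (m1.+1).-tuple R) (b : (m2.+1).-tuple R).

Definition sublevel (s t : nat) : {fset {fset V}} :=
  [fset x in K | (h1 x <= a`_s) && (h2 x <= b`_t)].

(* K_{s-1,t}, with K_{-1,t} empty *)
Definition sublevel_pred (s t : nat) : {fset {fset V}} :=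
  if s is s'.+1 then sublevel s' t else fset0.

Definition euler_surface : 'M[int]_(m1.+1, m2.+1) :=
  \matrix_(s < m1.+1, t < m2.+1) euler_char (sublevel s t).

End Surface.
End Complexes.

Section GeneralPosition.
Variables (R : realType) (d : nat).
Implicit Types (S X : {fset 'rV[R]_d}).

Definition affinely_independent S : Prop :=
  forall c : 'rV[R]_d -> R,
    \sum_(x <- S) c x = 0 -> \sum_(x <- S) c x *: x = 0 ->
    forall x, x \in S -> c x = 0.

Definition general_position X : Prop :=
  forall S, S `<=` X -> (#|` S| <= d.+1)%N -> affinely_independent S.

End GeneralPosition.

(* Computations on a mutable store St: they return a value and the final
   store, together with the number of elementary operations executed. *)
Section Machine.
Variable St : Type.

Definition comp (A : Type) : Type := St -> A * St * nat.

Definition bind (A B : Type) (c : comp A) (f : A -> comp B) : comp B :=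
  fun S => let: (x, S1, k1) := c S in
           let: (y, S2, k2) := f x S1 in (y, S2, (k1 + k2)%N).

Definition ret (A : Type) (x : A) : comp A := fun S => (x, S, 0%N).

(* One elementary operation that leaves the store unchanged: arithmetic or a
   comparison on scalars, or reading an input (an entry of a sorted list, or
   h1, h2 or the dimension at a given simplex). *)
Definition op (A : Type) (x : A) : comp A := fun S => (x, S, 1%N).

Definition result (A : Type) (c : comp A) (S : St) : A := (c S).1.1.
Definition final_store (A : Type) (c : comp A) (S : St) : St := (c S).1.2.
Definition time (A : Type) (c : comp A) (S : St) : nat := (c S).2.

End Machine.

Notation "'let*' x ':=' c 'in' f" := (bind c (fun x => f))
  (at level 200, x name, c at level 100, f at level 200,
   format "'[v' 'let*'  x  ':='  c  'in' '/' f ']'").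
Notation "c1 ;; c2" := (bind c1 (fun _ => c2))
  (at level 101, right associativity, format "'[v' c1 ;; '/' c2 ']'").

(* One operation of loop control per iteration, and one for the exit. *)
Fixpoint for_each (St I : Type) (r : seq I) (body : I -> comp St unit) :
    comp St unit :=
  if r is i :: r' then op tt;; body i;; for_each r' body else op tt.

Section BinarySearch.
Variables (St : Type) (R : realDomainType).

(* while lo < hi do
     mid := (lo + hi) / 2; if v <= a[mid] then hi := mid else lo := mid + 1 *)
Fixpoint bsearch_loop (fuel : nat) (a : seq R) (v : R) (lo hi : nat) :
    comp St nat :=
  if fuel is fuel'.+1 then
    let* continue := op (lo < hi)%N in
    if continue then
      let* sum := op (lo + hi)%N in
      let* mid := op sum./2 in
      let* x := op a`_mid in
      let* reached := op (v <= x) in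
      if reached then bsearch_loop fuel' a v lo mid
      else let* lo' := op mid.+1 in bsearch_loop fuel' a v lo' hi
    else ret lo
  else ret lo.

(* The interval [lo, hi) shrinks at every iteration, so that the fuel never
   runs out.  The answer is None when every entry of a is smaller than v. *)
Definition binary_search (m : nat) (a : (m.+1).-tuple R) (v : R) :
    comp St (option 'I_m.+1) :=
  let* i := bsearch_loop m.+2 a v 0 m.+1 in op (insub i).

End BinarySearch.

Section Procedure.
Variables (V : choiceType) (R : realDomainType) (m1 m2 : nat).
Local Notation matrix_store := 'M[int]_(m1.+1, m2.+1).

Definition get_entry (s : 'I_m1.+1) (t : 'I_m2.+1) : comp matrix_store int :=
  fun S => (S s t, S, 1%N).

Definition set_entry (s : 'I_m1.+1) (t : 'I_m2.+1) (z : int) :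
    comp matrix_store unit :=
  fun S => (tt,
            \matrix_(s', t') (if (s' == s) && (t' == t) then z else S s' t'),
            1%N).

Definition return_store : comp matrix_store matrix_store :=
  fun S => (S, S, 1%N).

Definition initialize : comp matrix_store unit :=
  for_each (enum 'I_m1.+1) (fun s =>
    for_each (enum 'I_m2.+1) (fun t => set_entry s t 0)).

Variables (h1 h2 : {fset V} -> R).
Variables (a : (m1.+1).-tuple R) (b : (m2.+1).-tuple R).

(* A simplex whose h1-value exceeds all a_s, or whose h2-value exceeds all
   b_t, leaves the matrix unchanged. *)
Definition process_simplex (x : {fset V}) : comp matrix_store unit :=
  let* v1 := op (h1 x) in
  let* v2 := op (h2 x) in
  let* os := binary_search a v1 in
  let* ot := binary_search b v2 in
  match os, ot with
  | Some s, Some t =>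
      for_each [seq t' : 'I_m2.+1 <- enum 'I_m2.+1 | (t <= t')%N] (fun t' =>
        let* k := op (dim x) in
        let* e := op ((-1) ^+ k : int) in
        let* z := get_entry s t' in
        let* z' := op (z + e) in
        set_entry s t' z')
  | _, _ => op tt
  end.

Definition main_loop (simplices : seq {fset V}) : comp matrix_store unit :=
  for_each simplices process_simplex.

(* for s = 0, ..., m1 - 1 and t = 0, ..., m2:  S[s+1][t] += S[s][t] *)
Definition cumulative_sum : comp matrix_store unit :=
  for_each (enum 'I_m1) (fun s =>
    for_each (enum 'I_m2.+1) (fun t =>
      let* z := get_entry (widen_ord (leqnSn m1) s) t in
      let* z' := get_entry (lift ord0 s) t in
      let* z'' := op (z + z') in
      set_entry (lift ord0 s) t z'')).

Definition until_main_loop (simplices : seq {fset V}) :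
    comp matrix_store unit :=
  initialize;; main_loop simplices.

Definition procedure_P (simplices : seq {fset V}) :
    comp matrix_store matrix_store :=
  until_main_loop simplices;; cumulative_sum;; return_store.

End Procedure.

Definition log2 (R : realType) (x : R) : R := ln x / ln 2.

(* Main.v *)
Require Import Defs.
From mathcomp Require Import all_boot all_order all_algebra finmap.
From mathcomp Require Import reals exp zify.

Set Implicit Arguments.
Unset Strict Implicit.
Unset Printing Implicit Defensive.

Import Order.TTheory GRing.Theory Num.Theory.

Local Open Scope fset_scope.
Local Open Scope ring_scope.

(* Processing a simplex x adds (-1)^dim x to the entries [s][t] such that s is
   the first index with h1 x <= a_s and h2 x <= b_t.  The indicator of
   "s is the first index with h1 x <= a_s" is the difference of those of
   h1 x <= a_s and h1 x <= a_{s-1}; summed over K this gives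
   chi(K_{s,t}) - chi(K_{s-1,t}), which the cumulative sum telescopes. *)

(** * Results, stores and costs of sequencing and loops *)

Lemma result_bind (St A B : Type) (c : Defs.comp St A)
    (f : A -> Defs.comp St B) (S : St) :
  result (bind c f) S = result (f (result c S)) (final_store c S).
Proof.
rewrite /result /final_store /bind.
by case: (c S) => -[x S1] k; case: f => -[].
Qed.

Lemma final_store_bind (St A B : Type) (c : Defs.comp St A)
    (f : A -> Defs.comp St B)
    (S : St) :
  final_store (bind c f) S = final_store (f (result c S)) (final_store c S).
Proof.
rewrite /result /final_store /bind.
by case: (c S) => -[x S1] k; case: f => -[].
Qed.

Lemma time_bind (St A B : Type) (c : Defs.comp St A)
    (f : A -> Defs.comp St B) (S : St) :
  time (bind c f) S =
  (time c S + time (f (result c S)) (final_store c S))%N.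
Proof.
rewrite /time /result /final_store /bind.
by case: (c S) => -[x S1] k /=; case: f => -[].
Qed.

Lemma time_bind_le (St A B : Type) (c : Defs.comp St A)
    (f : A -> Defs.comp St B) (k l : nat) (S : St) :
  (time c S <= k)%N -> (forall x S', time (f x) S' <= l)%N ->
  (time (bind c f) S <= k + l)%N.
Proof. by move=> ck fl; rewrite time_bind leq_add. Qed.

Lemma final_store_for_each (St I : Type) (r : seq I)
    (body : I -> Defs.comp St unit)
    (S : St) :
  final_store (for_each r body) S =
  foldl (fun S' i => final_store (body i) S') S r.
Proof. by elim: r S => //= i r IHr S; rewrite !final_store_bind -IHr. Qed.

Lemma time_for_each_le (St I : Type) (r : seq I)
    (body : I -> Defs.comp St unit)
    (k : nat) (S : St) :
  (forall i S', time (body i) S' <= k)%N ->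
  (time (for_each r body) S <= size r * k.+1 + 1)%N.
Proof.
move=> bodyk; elim: r S => [|i r IHr] S //=.
rewrite !time_bind {1}/time /=.
move: (bodyk i S) (IHr (final_store (body i) S)).
by rewrite /final_store /=; lia.
Qed.

(** * Binary search: outcome and logarithmic cost *)

(** The specification of the search. When no entry reaches [v] the value is [size a], an index
    outside the list. *)
Definition first_ge (R : realDomainType) (a : seq R) (v : R) : nat :=
  find (fun x => v <= x) a.

(** As [a] increases, the entries that are at least [v] form a final segment. Comparisons with grid
    values thus become comparisons of indices, both in the search and in the sublevel sets. *)
Lemma leq_first_ge (R : realDomainType) (a : seq R) (v : R) (i : nat) :
  sorted <%R a -> (i < size a)%N ->
  (first_ge a v <= i)%N = (v <= a`_i).
Proof.
move=> a_sorted ia; rewrite /first_ge; apply/idP/idP => [le_fi|]; last first.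
  by rewrite leqNgt; apply: contraTN => /(before_find 0) ->.
have fa := leq_ltn_trans le_fi ia.
have /(nth_find 0) /le_trans : has (fun x => v <= x) a by rewrite has_find.
by apply; rewrite (lt_sorted_leq_nth 0 a_sorted) ?inE.
Qed.

(** One iteration with its cost made explicit: five operations when the left half is kept, and a
    sixth for [mid + 1] when the right half is kept. *)
Lemma bsearch_loopS (St : Type) (R : realDomainType) (fuel : nat)
    (a : seq R) (v : R) (lo hi : nat) (S : St) :
  bsearch_loop fuel.+1 a v lo hi S =
  if (lo < hi)%N then
    let mid := (lo + hi)./2 in
    if v <= a`_mid then
      let: (i, S', k) := bsearch_loop fuel a v lo mid S in (i, S', k.+4.+1)
    else
      let: (i, S', k) := bsearch_loop fuel a v mid.+1 hi S in (i, S', k.+4.+2)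
  else (lo, S, 1%N).
Proof.
rewrite /= /bind /op; case: ifP => // _; case: ifP => _.
  by case: bsearch_loop => -[].
by case: bsearch_loop => -[].
Qed.

(** The loop invariant is [lo <= first_ge a v <= hi]. By [leq_first_ge] the comparison at [mid]
    tells which half preserves it, and on exit [lo = hi]. *)
Lemma result_bsearch_loop (St : Type) (R : realDomainType) (fuel : nat)
    (a : seq R) (v : R) (lo hi : nat) (S : St) :
  sorted <%R a -> (hi - lo < fuel)%N -> (hi <= size a)%N ->
  (lo <= first_ge a v <= hi)%N ->
  result (bsearch_loop fuel a v lo hi) S = first_ge a v.
Proof.
move=> a_sorted; elim: fuel lo hi => // fuel IHf lo hi hfuel hsz hf.
rewrite /result bsearch_loopS; case: ltnP => [lt_lohi|le_hilo] /=; last by lia.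
have mid_lt : ((lo + hi)./2 < hi)%N by lia.
have := leq_first_ge v a_sorted (leq_trans mid_lt hsz).
case: (v <= _) => hm.
  rewrite -[RHS](IHf lo (lo + hi)./2) /result; [|lia..].
  by case: bsearch_loop => -[].
rewrite -[RHS](IHf (lo + hi)./2.+1 hi) /result; [|lia..].
by case: bsearch_loop => -[].
Qed.

Lemma final_store_bsearch_loop (St : Type) (R : realDomainType) (fuel : nat)
    (a : seq R) (v : R) (lo hi : nat) (S : St) :
  final_store (bsearch_loop fuel a v lo hi) S = S.
Proof.
elim: fuel lo hi => // fuel IHf lo hi; rewrite /final_store bsearch_loopS.
case: ifP => // _ /=; case: ifP => _.
  rewrite -[RHS](IHf lo (lo + hi)./2) /final_store.
  by case: bsearch_loop => -[].
rewrite -[RHS](IHf (lo + hi)./2.+1 hi) /final_store.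
by case: bsearch_loop => -[].
Qed.

(** Each iteration at least halves [hi - lo], so the exponent [k] drops by one for at most six
    operations; the last operation is the failing test. *)
Lemma time_bsearch_loop_le (St : Type) (R : realDomainType) (fuel k : nat)
    (a : seq R) (v : R) (lo hi : nat) (S : St) :
  (hi - lo < 2 ^ k)%N ->
  (time (bsearch_loop fuel a v lo hi) S <= 6 * k + 1)%N.
Proof.
elim: fuel k lo hi => // fuel IHf k lo hi hk.
rewrite /time bsearch_loopS; case: ltnP => [lt_lohi|_] /=; last by lia.
case: k hk => [|k]; first by lia.
rewrite expnS => hk; case: ifP => _.
  have : (time (bsearch_loop fuel a v lo (lo + hi)./2) S <= 6 * k + 1)%N.
    by apply: IHf; lia.
  by rewrite /time; case: bsearch_loop => -[] /=; lia.
have : (time (bsearch_loop fuel a v (lo + hi)./2.+1 hi) S <= 6 * k + 1)%N.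
  by apply: IHf; lia.
by rewrite /time; case: bsearch_loop => -[] /=; lia.
Qed.

Lemma result_binary_search (St : Type) (R : realDomainType) (m : nat)
    (a : (m.+1).-tuple R) (v : R) (S : St) :
  sorted <%R a ->
  result (binary_search a v) S = insub (first_ge a v).
Proof.
move=> a_sorted; rewrite /binary_search result_bind.
rewrite result_bsearch_loop ?size_tuple ?subn0 //.
by rewrite /= (leq_trans (find_size _ _)) ?size_tuple.
Qed.

Lemma final_store_binary_search (St : Type) (R : realDomainType) (m : nat)
    (a : (m.+1).-tuple R) (v : R) (S : St) :
  final_store (binary_search a v) S = S.
Proof. by rewrite /binary_search final_store_bind final_store_bsearch_loop. Qed.

Lemma time_binary_search_le (St : Type) (R : realDomainType) (m : nat)
    (a : (m.+1).-tuple R) (v : R) (S : St) :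
  (time (binary_search a v) S <= 6 * trunc_log 2 m + 14)%N.
Proof.
rewrite /binary_search time_bind [X in (_ + X)%N](_ : _ = 1%N) //.
have lt_m := @trunc_log_ltn 2 m isT.
(* The search interval has length [m + 1], which may equal [2 ^ (trunc_log 2 m).+1]; a strict bound
   takes one more doubling. *)
have : (m.+1 - 0 < 2 ^ (trunc_log 2 m).+2)%N.
  by rewrite subn0 [in ltnRHS]expnS; lia.
by move=> /(time_bsearch_loop_le m.+2 a v S); lia.
Qed.

(** * Effect of the loops on the matrix *)

(* The value written at column t may depend on column t only, so that the
   earlier iterations do not affect it. *)
Lemma final_store_for_each_row (m n : nat) (s : 'I_m)
    (body : 'I_n -> Defs.comp 'M[int]_(m, n) unit)
    (F : 'I_n -> 'cV[int]_m -> int)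
    (r : seq 'I_n) (S : 'M[int]_(m, n)) :
  (forall t S', final_store (body t) S' =
     \matrix_(s', t') if (s' == s) && (t' == t) then F t (col t S')
                      else S' s' t') ->
  uniq r ->
  final_store (for_each r body) S =
  \matrix_(s', t') if (s' == s) && (t' \in r) then F t' (col t' S)
                   else S s' t'.
Proof.
move=> bodyE; rewrite final_store_for_each.
elim: r S => [|t r IHr] S /=.
  by move=> _; apply/matrixP => s' t'; rewrite mxE andbF.
case/andP=> tr r_uniq; rewrite IHr // bodyE.
apply/matrixP => s' t'; rewrite !mxE inE.
case: eqVneq => //= _; have [-> | tt'] /= := eqVneq t' t.
  by rewrite (negbTE tr).
congr (if _ then F _ _ else _); apply/matrixP => i j.
by rewrite !mxE (negbTE tt') andbF.
Qed.

Lemma final_store_initialize (m1 m2 : nat) (S : 'M[int]_(m1.+1, m2.+1)) :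
  final_store (@initialize m1 m2) S = 0.
Proof.
rewrite /initialize final_store_for_each.
have rowE s S' : final_store (for_each (enum 'I_m2.+1)
    (fun t => set_entry s t 0)) S' =
    \matrix_(s', t') if s' == s then 0 else S' s' t'.
  rewrite (@final_store_for_each_row _ _ s _ (fun _ _ => 0)) ?enum_uniq //.
  by apply/matrixP => s' t'; rewrite !mxE mem_enum andbT.
have -> r : foldl (fun S' s => final_store (for_each (enum 'I_m2.+1)
    (fun t => set_entry s t 0)) S') S r =
    \matrix_(s, t) if s \in r then 0 else S s t.
  elim: r S => [|s r IHr] S'; first by apply/matrixP => s' t'; rewrite !mxE.
  rewrite /= IHr rowE; apply/matrixP => s' t'; rewrite !mxE inE.
  by case: eqVneq => // _; case: ifP.
by apply/matrixP => s t; rewrite !mxE mem_enum.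
Qed.

(** This is zero for a simplex beyond the last grid value in either direction: [first_ge] is then
    [m1.+1] or [m2.+1], which no row index equals and no column index reaches. *)
Definition increment (V : choiceType) (R : realDomainType) (m1 m2 : nat)
    (h1 h2 : {fset V} -> R) (a : (m1.+1).-tuple R) (b : (m2.+1).-tuple R)
    (x : {fset V}) : 'M[int]_(m1.+1, m2.+1) :=
  \matrix_(s, t) ((-1) ^+ Defs.dim x *+ ((first_ge a (h1 x) == s) &&
                                   (first_ge b (h2 x) <= t)%N)).

Lemma final_store_process_simplex (V : choiceType) (R : realDomainType)
    (m1 m2 : nat) (h1 h2 : {fset V} -> R) (a : (m1.+1).-tuple R)
    (b : (m2.+1).-tuple R) (x : {fset V}) (S : 'M[int]_(m1.+1, m2.+1)) :
  sorted <%R a -> sorted <%R b ->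
  final_store (process_simplex h1 h2 a b x) S = S + increment h1 h2 a b x.
Proof.
move=> a_sorted b_sorted; rewrite /process_simplex 4!final_store_bind.
rewrite result_binary_search // result_binary_search //.
rewrite !final_store_binary_search /result /final_store /= -/(final_store _ _).
case: insubP => [s _ sE|fa]; last first.
  apply/matrixP => s t; rewrite !mxE.
  case: eqP => [fs|]; last by rewrite addr0.
  by rewrite fs ltn_ord in fa.
case: insubP => [t _ tE|fb]; last first.
  apply/matrixP => s' t'; rewrite !mxE.
  have -> : (first_ge b (h2 x) <= t')%N = false by have := ltn_ord t'; lia.
  by rewrite andbF addr0.
rewrite (@final_store_for_each_row _ _ s _
  (fun _ c => c s 0 + (-1) ^+ Defs.dim x)) ?filter_uniq //.
- apply/matrixP => s' t'; rewrite !mxE mem_filter mem_enum andbT -sE -tE.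
  rewrite [_ == val s' :> nat]eq_sym val_eqE.
  case: eqVneq => [->|_]; case: (leqP (val t) t') => //= _;
    by rewrite ?mulr1n ?mulr0n ?addr0.
- by move=> t' S'; apply/matrixP => i j; rewrite !mxE.
- by rewrite -enumT enum_uniq.
Qed.

Lemma final_store_main_loop (V : choiceType) (R : realDomainType)
    (m1 m2 : nat) (h1 h2 : {fset V} -> R) (a : (m1.+1).-tuple R)
    (b : (m2.+1).-tuple R) (simplices : seq {fset V})
    (S : 'M[int]_(m1.+1, m2.+1)) :
  sorted <%R a -> sorted <%R b ->
  final_store (main_loop h1 h2 a b simplices) S =
  S + \sum_(x <- simplices) increment h1 h2 a b x.
Proof.
move=> a_sorted b_sorted; rewrite /main_loop final_store_for_each.
elim: simplices S => [|x r IHr] S /=; first by rewrite big_nil addr0.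
by rewrite IHr final_store_process_simplex // big_cons addrA.
Qed.

(** Column prefix sums are determined by their recurrence. Taking any solution [T] lets the Euler
    characteristic surface be substituted directly, without writing out sums. *)
Lemma final_store_cumulative_sum (m1 m2 : nat)
    (S T : 'M[int]_(m1.+1, m2.+1)) :
  (forall t, T ord0 t = S ord0 t) ->
  (forall (s : 'I_m1) t,
     T (lift ord0 s) t = T (widen_ord (leqnSn m1) s) t + S (lift ord0 s) t) ->
  final_store (@cumulative_sum m1 m2) S = T.
Proof.
move=> T0 TS; rewrite /cumulative_sum final_store_for_each.
set step := (fun S' s => _).
have stepE S' (s : 'I_m1) : step S' s =
    \matrix_(s', t) if s' == lift ord0 s
                    then S' (widen_ord (leqnSn m1) s) t + S' s' t
                    else S' s' t.
  rewrite /step (@final_store_for_each_row _ _ (lift ord0 s) _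
    (fun _ c => c (widen_ord (leqnSn m1) s) 0 + c (lift ord0 s) 0)).
  - apply/matrixP => s' t'; rewrite !mxE mem_enum andbT.
    by case: eqP => // ->.
  - by move=> t' S''; apply/matrixP => i j; rewrite !mxE.
  - exact: enum_uniq.
(* Loop invariant: after [k] iterations rows 0 to [k] are final and the later rows still hold [S].
   The next iteration combines the final row [k] with the original row [k + 1]. *)
have prefixE k : (k <= m1)%N -> foldl step S (take k (enum 'I_m1)) =
    \matrix_(s, t) if (s <= k)%N then T s t else S s t.
  elim: k => [_|k IHk lt_k].
    rewrite take0; apply/matrixP => s t; rewrite !mxE leqn0.
    by case: eqP => // s0; rewrite (_ : s = ord0) ?T0 //; apply: val_inj.
  pose k' := Ordinal lt_k.
  rewrite (take_nth k') ?size_enum_ord // foldl_rcons IHk ?(ltnW lt_k) //.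
  rewrite (_ : nth k' _ k = k'); last first.
    by apply: val_inj; rewrite /= nth_enum_ord.
  rewrite stepE; apply/matrixP => s t; rewrite !mxE /= leqnn.
  case: eqVneq => [->|ne_s].
    by rewrite TS /= /bump /= add1n leqnn ltnn.
  have : (s != k.+1 :> nat)%N.
    by apply: contra ne_s => /eqP sk; apply/eqP/val_inj.
  by move=> nk; rewrite [in RHS]leq_eqVlt ltnS (negbTE nk).
rewrite -[enum _]take_size size_enum_ord prefixE //.
by apply/matrixP => s t; rewrite mxE -ltnS ltn_ord.
Qed.

(** * Euler characteristics as signed sums over simplices *)

(** Each simplex is counted in exactly one dimension class, and its dimension lies below [d] because
    [d] is one more than the maximum over [Y]. *)
Lemma euler_charE (V : choiceType) (Y : {fset {fset V}}) :
  euler_char Y = \sum_(x <- Y) (-1) ^+ Defs.dim x.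
Proof.
rewrite /euler_char; set d := (\max_(_ <- _) _).+1.
transitivity
  (\sum_(i < d) \sum_(x <- Y | Defs.dim x == i) (-1) ^+ Defs.dim x : int).
  apply: eq_bigr => i _; rewrite big_fset_condE /=.
  rewrite (eq_big_seq (fun=> (-1) ^+ i)) => [|x]; last first.
    by rewrite !inE => /andP[_ /eqP->].
  by rewrite big_const_seq count_predT iter_addr_0 pmulrn -mulrzr intz.
rewrite (exchange_big_dep xpredT) //= big_seq [RHS]big_seq.
apply: eq_bigr => x xY.
have lt_xd : (Defs.dim x < d)%N by rewrite ltnS (leq_bigmax_seq x).
by rewrite (big_pred1 (Ordinal lt_xd)) // => i; rewrite /= eq_sym -val_eqE.
Qed.

(** With indicators, all sublevel sets are summed over the same index set [K] and can be subtracted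
    term by term. *)
Lemma euler_char_sublevel (V : choiceType) (R : realDomainType) (m1 m2 : nat)
    (K : {fset {fset V}}) (h1 h2 : {fset V} -> R) (a : (m1.+1).-tuple R)
    (b : (m2.+1).-tuple R) (s t : nat) :
  euler_char (sublevel K h1 h2 a b s t) =
  \sum_(x <- K) (-1) ^+ Defs.dim x *+ ((h1 x <= a`_s) && (h2 x <= b`_t)).
Proof.
rewrite euler_charE /sublevel -big_fset_condE big_mkcond.
by apply: eq_bigr => x _; case: (_ && _).
Qed.

Lemma sum_increment (V : choiceType) (R : realDomainType) (m1 m2 : nat)
    (K : {fset {fset V}}) (h1 h2 : {fset V} -> R) (a : (m1.+1).-tuple R)
    (b : (m2.+1).-tuple R) (s : 'I_m1.+1) (t : 'I_m2.+1) :
  sorted <%R a -> sorted <%R b ->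
  \sum_(x <- K) increment h1 h2 a b x s t =
  euler_char (sublevel K h1 h2 a b s t)
  - euler_char (sublevel_pred K h1 h2 a b s t).
Proof.
move=> a_sorted b_sorted.
(* The strict inequality [first_ge a (h1 x) < s] handles both cases at once: it is false for
   [s = 0], matching the empty complex, and means [h1 x <= a_(s-1)] otherwise. *)
have -> : euler_char (sublevel_pred K h1 h2 a b s t) = \sum_(x <- K)
    (-1) ^+ Defs.dim x *+ ((first_ge a (h1 x) < s)%N && (h2 x <= b`_t)).
  case: s => -[|s] lt_s /=.
    by rewrite euler_charE big_seq_fset0 big1.
  rewrite euler_char_sublevel; apply: eq_bigr => x _.
  by rewrite ltnS leq_first_ge ?size_tuple // ltnW.
rewrite euler_char_sublevel -sumrB; apply: eq_bigr => x _; rewrite mxE.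
rewrite -!leq_first_ge ?size_tuple ?ltn_ord //.
case: (_ <= t)%N; rewrite ?andbF ?subrr ?andbT //.
by case: ltngtP => _; rewrite ?subrr ?subr0.
Qed.

(** * Correctness of the procedure *)

Lemma final_store_until_main_loop (V : choiceType) (R : realDomainType)
    (m1 m2 : nat) (K : {fset {fset V}}) (h1 h2 : {fset V} -> R)
    (a : (m1.+1).-tuple R) (b : (m2.+1).-tuple R) (simplices : seq {fset V})
    (S : 'M[int]_(m1.+1, m2.+1)) (s : 'I_m1.+1) (t : 'I_m2.+1) :
  sorted <%R a -> sorted <%R b -> perm_eq simplices (enum_fset K) ->
  final_store (until_main_loop h1 h2 a b simplices) S s t =
  euler_char (sublevel K h1 h2 a b s t)
  - euler_char (sublevel_pred K h1 h2 a b s t).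
Proof.
move=> a_sorted b_sorted simplicesK; rewrite /until_main_loop final_store_bind.
rewrite final_store_main_loop // final_store_initialize add0r summxE.
by rewrite (perm_big _ simplicesK) sum_increment.
Qed.

Lemma result_procedure_P (V : choiceType) (R : realDomainType)
    (m1 m2 : nat) (K : {fset {fset V}}) (h1 h2 : {fset V} -> R)
    (a : (m1.+1).-tuple R) (b : (m2.+1).-tuple R) (simplices : seq {fset V})
    (S : 'M[int]_(m1.+1, m2.+1)) :
  sorted <%R a -> sorted <%R b -> perm_eq simplices (enum_fset K) ->
  result (procedure_P h1 h2 a b simplices) S = euler_surface K h1 h2 a b.
Proof.
move=> a_sorted b_sorted simplicesK; rewrite /procedure_P !result_bind.
(* The surface satisfies the prefix-sum recurrence: in row 0 the subtracted term is the Euler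
   characteristic of the empty complex, and in later rows it cancels against the row before. *)
rewrite {1}/result /=; apply: final_store_cumulative_sum => [t|s t].
  rewrite (final_store_until_main_loop _ _ _ _ _ a_sorted b_sorted simplicesK).
  by rewrite mxE /= [X in _ - X]euler_charE big_seq_fset0 subr0.
rewrite (final_store_until_main_loop _ _ _ _ _ a_sorted b_sorted simplicesK).
by rewrite !mxE /= addrC subrK.
Qed.

(** * Running time *)

Lemma time_process_simplex_le (V : choiceType) (R : realDomainType)
    (m1 m2 : nat) (h1 h2 : {fset V} -> R) (a : (m1.+1).-tuple R)
    (b : (m2.+1).-tuple R) (x : {fset V}) (S : 'M[int]_(m1.+1, m2.+1)) :
  (time (process_simplex h1 h2 a b x) S
     <= 6 * (trunc_log 2 m1 + trunc_log 2 m2 + m2) + 37)%N.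
Proof.
(* The bound is split along the program: two reads, two searches, then at most [m2.+1] columns at
   five operations plus one of loop control each, and the loop exit. *)
rewrite (_ : (_ + 37)%N = 1 + (1 + ((6 * trunc_log 2 m1 + 14) +
  ((6 * trunc_log 2 m2 + 14) + (m2.+1 * 6 + 1)))))%N; last by lia.
apply: time_bind_le => // v1 S1; apply: time_bind_le => // v2 S2.
apply: time_bind_le => [|[s|] S3]; first exact: time_binary_search_le.
  apply: time_bind_le => [|[t|] S4]; first exact: time_binary_search_le.
    apply: leq_trans (@time_for_each_le _ _ _ _ 5 _ _) _ => //.
    rewrite leq_add2r leq_mul2r size_filter (leq_trans (count_size _ _)) //.
    by rewrite size_enum_ord.
  by rewrite /time /=; lia.
apply: time_bind_le => [|ot S4]; first exact: time_binary_search_le.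
by rewrite /time /=; lia.
Qed.

(** Taking logarithms in [2 ^ trunc_log 2 m <= m]. *)
Lemma trunc_log2_le_log2 (R : realType) (m : nat) :
  (0 < m)%N -> (trunc_log 2 m)%:R <= log2 m%:R :> R.
Proof.
move=> m_gt0; have ln2_gt0 : 0 < ln 2 :> R by rewrite ln_gt0 ?ltr1n.
rewrite /log2 ler_pdivlMr // mulr_natl -lnXn //.
rewrite ler_ln ?posrE ?exprn_gt0 ?ltr0n //.
by rewrite -natrX ler_nat trunc_logP.
Qed.

Lemma time_procedure_P_le (V : choiceType) (R : realDomainType)
    (m1 m2 : nat) (h1 h2 : {fset V} -> R)
    (a : (m1.+1).-tuple R) (b : (m2.+1).-tuple R) (simplices : seq {fset V})
    (S : 'M[int]_(m1.+1, m2.+1)) :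
  (0 < m1)%N -> (0 < m2)%N ->
  (time (procedure_P h1 h2 a b simplices) S
     <= 44 * (size simplices * (trunc_log 2 m1 + trunc_log 2 m2 + m2)
              + m1 * m2))%N.
Proof.
move=> m1_gt0 m2_gt0.
set l := (trunc_log 2 m1 + trunc_log 2 m2 + m2)%N.
have tI S' : (time (@initialize m1 m2) S' <= m1.+1 * (2 * m2 + 4) + 1)%N.
  rewrite -[X in (_ <= X * _ + _)%N](size_enum_ord m1.+1).
  (* An entry costs one write and one loop step; a row adds its loop exit and one step of the outer
     loop. *)
  rewrite (_ : 2 * m2 + 4 = (m2.+1 * 2 + 1).+1)%N; last by lia.
  apply: time_for_each_le => s S1.
  by rewrite -[X in (_ <= X * _ + _)%N](size_enum_ord m2.+1) time_for_each_le.
have tC S' : (time (@cumulative_sum m1 m2) S' <= m1 * (5 * m2 + 7) + 1)%N.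
  rewrite -[X in (_ <= X * _ + _)%N](size_enum_ord m1).
  (* Here an entry costs two reads, an addition, a write and a loop step. *)
  rewrite (_ : 5 * m2 + 7 = (m2.+1 * 5 + 1).+1)%N; last by lia.
  apply: time_for_each_le => s S1.
  by rewrite -[X in (_ <= X * _ + _)%N](size_enum_ord m2.+1) time_for_each_le.
have tM S' : (time (main_loop h1 h2 a b simplices) S'
               <= size simplices * (6 * l + 37).+1 + 1)%N.
  by apply: time_for_each_le => x S1; apply: time_process_simplex_le.
have le_tP : (time (procedure_P h1 h2 a b simplices) S <=
    (m1.+1 * (2 * m2 + 4) + 1 + (size simplices * (6 * l + 37).+1 + 1))
    + ((m1 * (5 * m2 + 7) + 1) + 1))%N.
  by do 2![apply: time_bind_le => // *]; apply: time_bind_le.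
apply: leq_trans le_tP _.
(* Positivity of [m1] and [m2] absorbs the lower-order terms. Since [1 <= l], a simplex costs at
   most [6 * l + 38 <= 44 * l], whence the constant; the matrix passes need only
   [28 * (m1 * m2)]. *)
have : (m2 <= m1 * m2)%N by rewrite leq_pmull.
have : (m1 <= m1 * m2)%N by rewrite leq_pmulr.
have : (size simplices <= size simplices * l)%N by rewrite leq_pmulr // /l; lia.
by nia.
Qed.

Theorem mainTheorem3 :
  exists C : nat,
  forall (R : realType) (d : nat) (X : {fset 'rV[R]_d})
    (K : {fset {fset 'rV[R]_d}}) (h1 h2 : {fset 'rV[R]_d} -> R)
    (n m1 m2 : nat) (a : (m1.+1).-tuple R) (b : (m2.+1).-tuple R)
    (simplices : seq {fset 'rV[R]_d}) (S0 : 'M[int]_(m1.+1, m2.+1)),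
  general_position X ->
  simplicial_complex_on X K ->
  #|` K| = n ->
  filtering_function K h1 ->
  filtering_function K h2 ->
  sorted <%R a ->
  sorted <%R b ->
  (* the simplices of K, each listed once, in any order *)
  perm_eq simplices (enum_fset K) ->
  [/\ forall (s : 'I_m1.+1) (t : 'I_m2.+1),
        final_store (until_main_loop h1 h2 a b simplices) S0 s t =
        euler_char (sublevel K h1 h2 a b s t)
        - euler_char (sublevel_pred K h1 h2 a b s t),
      result (procedure_P h1 h2 a b simplices) S0 =
        euler_surface K h1 h2 a b &
      (0 < m1)%N -> (0 < m2)%N ->
      (time (procedure_P h1 h2 a b simplices) S0)%:R <=
        C%:R * (n%:R * (log2 m1%:R + log2 m2%:R + m2%:R) + m1%:R * m2%:R)
          :> R].
Proof.
exists 44%N => R d X K h1 h2 n m1 m2 a b simplices S0 _ _ Kn _ _ a_sorted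
  b_sorted simplicesK.
split=> [s t||m1_gt0 m2_gt0].
- exact: final_store_until_main_loop.
- exact: result_procedure_P.
have size_n : size simplices = n by rewrite (perm_size simplicesK) -Kn.
have := time_procedure_P_le h1 h2 a b simplices S0 m1_gt0 m2_gt0.
rewrite size_n -(ler_nat R) => /le_trans-> //.
(* The integer and real bounds differ only in the logarithms, so monotonicity reduces the goal to
   comparing these. *)
rewrite natrM natrD !natrM !natrD ler_wpM2l // lerD2r ler_wpM2l // lerD2r.
by rewrite lerD ?trunc_log2_le_log2.
Qed.
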